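(* For every $n\ge 1$, $$M_n(q,t)=M_{n-1}(q,qt)+\sum_{k=2}^{n}\Big[M_{k-1}(q,t)+(q^{k-1}t-1)M_{k-2}(q,t)\Big]M_{n-k}(q,q^kt),$$ and $$M_n(q,t)=M_{n-1}(q,t)+\sum_{k=0}^{n-2}M_k(q,t)\Big[M_{n-k-1}(q,q^kt)+(q^{n-1}t-1)M_{n-k-2}(q,q^kt)\Big].$$
   Context: For a permutation $\sigma=b_1\ldots b_m$ of $[m]$, $\mathrm{des}\,\sigma=\#\{i:b_i>b_{i+1}\}$ and $\mathrm{maj}\,\sigma=\sum_{b_i>b_{i+1}}i$. $\mathrm{Av}_m(321)$ is the set of permutations of $[m]$ with no $i<j<k$ such that $b_i>b_j>b_k$. Define $M_m(q,t)=\sum_{\sigma\in\mathrm{Av}_m(321)}q^{\mathrm{maj}\,\sigma}t^{\mathrm{des}\,\sigma}$ for $m\ge0$, with $M_0(q,t)=1$; $M_m(q,u)$ denotes this polynomial with $t$ replaced by $u$. *)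

(* Defs.v *)
From mathcomp Require Import all_boot all_order all_algebra all_fingroup.

Set Implicit Arguments.
Unset Strict Implicit.
Unset Printing Implicit Defensive.

Import GRing.Theory.
Local Open Scope ring_scope.

(* A permutation b_1 ... b_m of [m] is s : 'S_m, with b_(i+1) = s i + 1: both
   positions and values are shifted down by one. *)
Definition is_descent (m : nat) (s : 'S_m) (i : 'I_m) : bool :=
  [exists j : 'I_m, (nat_of_ord j == i.+1) && (s j < s i)%N].

Definition des (m : nat) (s : 'S_m) : nat := #|[set i | is_descent s i]|.

(* The 0-based position i is position i.+1 in the usual numbering. *)
Definition maj (m : nat) (s : 'S_m) : nat :=
  (\sum_(i < m | is_descent s i) i.+1)%N.

Definition avoids321 (m : nat) (s : 'S_m) : bool :=
  ~~ [exists i : 'I_m, exists j : 'I_m, exists k : 'I_m,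
        [&& (i < j)%N, (j < k)%N, (s j < s i)%N & (s k < s j)%N]].

(* Z[q,t] is represented as Z[q][t]. *)
Notation Zqt := {poly {poly int}}.

Definition q : Zqt := ('X : {poly int})%:P.
Definition t : Zqt := 'X.

Definition Mpoly (m : nat) : Zqt :=
  \sum_(s : 'S_m | avoids321 s) q ^+ maj s * t ^+ des s.

(* M m u is M_m(q,u). *)
Definition M (m : nat) (u : Zqt) : Zqt := Mpoly m \Po u.

(* Main.v *)
Require Import Defs.
From mathcomp Require Import all_boot all_order all_algebra all_fingroup.
From mathcomp Require Import zify ring.

(* A 321-avoiding permutation is determined by its sequence f of prefix maxima
   (positions that are not records receive the least unused value), and these
   sequences are the weakly increasing f with i < f_i <= n, that is, Dyck paths.
   A descent at i means that i is a record and i+1 is not, i.e. a factor UDD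
   whose first D is the (i+1)-st down step.  Hence M_n(q,t) is the sum over Dyck
   paths of the product of q^(i+1) t over the factors UDD.  Splitting U A D B at
   the first return gives the first identity: the down step after A creates a
   new factor UDD exactly when A ends with UD, and B is shifted by q^k.  The
   second identity follows by regrouping around the last prime factor. *)

Import GRing.Theory.
Local Open Scope ring_scope.

(** * Prefix maxima of 321-avoiding permutations *)

Lemma avoids321P (n : nat) (s : 'S_n) :
  reflect (forall i j k : 'I_n, (i < j < k)%N -> ~~ (s k < s j < s i)%N)
          (avoids321 s).
Proof.
apply: (iffP negP) => [H i j k /andP[ij jk]|H].
  apply/negP => /andP[kj ji]; apply: H.
  by apply/existsP; exists i; apply/existsP; exists j; apply/existsP; exists k;
     rewrite ij jk ji kj.
case/existsP=> i /existsP[j /existsP[k /and4P[ij jk ji kj]]].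
by have := H i j k; rewrite ij jk ji kj => /(_ isT).
Qed.

Definition prefix_max (n : nat) (s : 'S_n) (i : nat) : nat :=
  \max_(j < n | (j < i)%N) (s j).+1.

Definition prefix_maxima (n : nat) (s : 'S_n) : seq nat :=
  mkseq (fun i => prefix_max n s i.+1) n.

Lemma prefix_max0 (n : nat) (s : 'S_n) : prefix_max n s 0 = 0%N.
Proof. by rewrite /prefix_max big_pred0. Qed.

Lemma prefix_maxS (n : nat) (s : 'S_n) (i : 'I_n) :
  prefix_max n s i.+1 = maxn (prefix_max n s i) (s i).+1.
Proof.
rewrite /prefix_max (bigD1 i) //= maxnC; congr maxn.
by apply: eq_bigl => j; rewrite -val_eqE /=; lia.
Qed.

Lemma prefix_max_ge (n : nat) (s : 'S_n) (i : nat) (j : 'I_n) :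
  (j < i)%N -> (s j < prefix_max n s i)%N.
Proof. by move=> ji; rewrite /prefix_max (bigD1 j) //= leq_maxl. Qed.

Lemma prefix_max_attained (n : nat) (s : 'S_n) (i v : nat) :
  (v < prefix_max n s i)%N -> exists2 k : 'I_n, (k < i)%N & (v <= s k)%N.
Proof.
case: (boolP [exists k : 'I_n, (k < i)%N && (v <= s k)%N]).
  by case/existsP=> k /andP[ki vk] _; exists k.
rewrite negb_exists => /forallP H; rewrite ltnNge => /negP[].
by apply/bigmax_leqP => k ki; have := H k; rewrite ki /= -ltnNge.
Qed.

Lemma prefix_max_le (n : nat) (s : 'S_n) (i : nat) : (prefix_max n s i <= n)%N.
Proof. by apply/bigmax_leqP => k _; apply: ltn_ord. Qed.

Lemma prefix_max_mono (n : nat) (s : 'S_n) (i j : nat) :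
  (i <= j)%N -> (prefix_max n s i <= prefix_max n s j)%N.
Proof.
by move=> ij; apply/bigmax_leqP => k ki; apply: prefix_max_ge; lia.
Qed.

(** Pigeonhole: the first [i] positions carry distinct values, all below the prefix maximum. *)
Lemma prefix_max_geq (n : nat) (s : 'S_n) (i : nat) :
  (i <= n)%N -> (i <= prefix_max n s i)%N.
Proof.
move=> le_in.
pose w (j : 'I_i) : 'I_n := widen_ord le_in j.
have wlt j : (s (w j) < prefix_max n s i)%N by apply: prefix_max_ge => /=.
have := @leq_card _ _ (fun j => Ordinal (wlt j)); rewrite !card_ord; apply.
by move=> j k /(congr1 val)/= /val_inj/perm_inj/(congr1 val)/= /val_inj.
Qed.

(* The entries are positive in use, so the leading 0 makes position 0 a record
   and the default value 0 excludes the last position. *)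
Definition record_plateau (f : seq nat) (i : nat) : bool :=
  (nth 0 (0 :: f) i < nth 0 f i)%N && (nth 0 f i == nth 0 f i.+1)%N.

Lemma nth_prefix_maxima (n : nat) (s : 'S_n) (i : nat) :
  (i <= n)%N -> nth 0%N (0%N :: prefix_maxima n s) i = prefix_max n s i.
Proof.
case: i => [|i] lt_in /=; first by rewrite prefix_max0.
by rewrite nth_mkseq.
Qed.

(** If a descent [i] were not a record, an earlier larger entry would complete a 321. Conversely, an
    unchanged maximum after a record forces the next value to be smaller. *)
Lemma descent_record_plateau (n : nat) (s : 'S_n) (i : 'I_n) :
  avoids321 s -> is_descent s i = record_plateau (prefix_maxima n s) i.
Proof.
move=> /avoids321P av.
have lt_in := ltn_ord i.
rewrite /record_plateau nth_prefix_maxima ?(ltnW lt_in) // nth_mkseq //.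
have Ei := prefix_maxS n s i.
apply/existsP/andP => [[j /andP[/eqP ji lt_ji]]|[rec]].
  have lt_jn := ltn_ord j; rewrite nth_mkseq; last by rewrite -ji.
  have Ej := prefix_maxS n s j; rewrite ji in Ej.
  case: (leqP (prefix_max n s i) (s i)) => [le_i|]; first by split; lia.
  case/prefix_max_attained=> k ki le_ik.
  have neq : val (s i) != s k.
    by apply/eqP => /val_inj/perm_inj E; move: ki; rewrite E ltnn.
  have kij : (k < i < j)%N by lia.
  case/negP: (av k i j kij).
  by rewrite lt_ji ltn_neqAle neq le_ik.
case: (ltnP i.+1 n) => [lt_i1n|ge]; last first.
  by rewrite [X in _ == X]nth_default ?size_mkseq //; lia.
rewrite nth_mkseq // => /eqP E.
have Ej := prefix_maxS n s (Ordinal lt_i1n); rewrite /= in Ej.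
exists (Ordinal lt_i1n); rewrite eqxx /=.
have neq : val (s (Ordinal lt_i1n)) != s i.
  by apply/eqP => /val_inj/perm_inj/(congr1 val)/=; lia.
by rewrite ltn_neqAle neq /=; lia.
Qed.

(** If [s i < s' i], equality of the maxima makes [i] a non-record of [s'], and agreement before [i]
    pushes the value [s i] to a later position of [s']. An earlier larger entry, [s' i] and [s i]
    then form a 321 in [s']. *)
Lemma prefix_max_determines_step (n : nat) (s s' : 'S_n) (i : 'I_n) :
  avoids321 s' -> (forall j : 'I_n, (j < i)%N -> s j = s' j) ->
  prefix_max n s i = prefix_max n s' i ->
  prefix_max n s i.+1 = prefix_max n s' i.+1 -> ~~ (s i < s' i)%N.
Proof.
move=> /avoids321P av agree E; rewrite !prefix_maxS => E1; apply/negP => lt_i.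
pose j := (s'^-1)%g (s i); have s'j : s' j = s i by rewrite permKV.
have lt_ij : (i < j)%N.
  case: (ltngtP i j) => // [lt_ji|/val_inj E2].
    by move: s'j; rewrite -(agree _ lt_ji) => /perm_inj E2; rewrite E2 ltnn in lt_ji.
  by rewrite -E2 in s'j; rewrite s'j ltnn in lt_i.
have /prefix_max_attained[k ki le_ik] : (s' i < prefix_max n s' i)%N by lia.
have neq : val (s' i) != s' k.
  by apply/eqP => /val_inj/perm_inj E2; move: ki; rewrite E2 ltnn.
have kij : (k < i < j)%N by lia.
case/negP: (av k i j kij).
by rewrite s'j lt_i ltn_neqAle neq le_ik.
Qed.

Lemma prefix_maxima_inj (n : nat) :
  {in [pred s | avoids321 s] &, injective (prefix_maxima n)}.
Proof.
move=> s s'; rewrite !inE => av av' E.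
have Em i : (i <= n)%N -> prefix_max n s i = prefix_max n s' i.
  by move=> le_in; rewrite -!nth_prefix_maxima // E.
suff H k (i : 'I_n) : (i < k)%N -> s i = s' i by apply/permP => i; apply: (H i.+1).
elim: k i => // k IH i le_ik.
have agree (j : 'I_n) : (j < i)%N -> s j = s' j by move=> ji; apply: IH; lia.
have lt_in := ltn_ord i.
have := @prefix_max_determines_step n s s' i av' agree (Em _ (ltnW lt_in)) (Em _ lt_in).
have := @prefix_max_determines_step n s' s i av
  (fun j ji => esym (agree j ji)) (esym (Em _ (ltnW lt_in))) (esym (Em _ lt_in)).
by move=> H1 H2; apply: val_inj => /=; lia.
Qed.

(** * Ballot sequences and the bijection with permutations *)

(** These encode Dyck paths of semilength [n]: entry [i] counts the up steps before the down step
    number [i.+1]. *)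
Definition ballot (n : nat) (f : seq nat) : Prop :=
  [/\ size f = n,
      forall i j, (i <= j < n)%N -> (nth 0 f i <= nth 0 f j)%N
    & forall i, (i < n)%N -> (i < nth 0 f i <= n)%N].

Lemma prefix_maxima_ballot (n : nat) (s : 'S_n) : ballot n (prefix_maxima n s).
Proof.
split=> [|i j ij|i lt_in]; first by rewrite size_mkseq.
  by rewrite !nth_mkseq; try lia; apply: prefix_max_mono; lia.
by rewrite nth_mkseq // prefix_max_le prefix_max_geq.
Qed.

Lemma exists_unused (g : nat -> nat) (k : nat) :
  exists2 v, (v <= k)%N & forall j, (j < k)%N -> g j != v.
Proof.
case: (boolP (all (mem (map g (iota 0 k))) (iota 0 k.+1))) => [/allP sub|].
  have := uniq_leq_size (iota_uniq 0 k.+1) (s2 := map g (iota 0 k)) sub.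
  by rewrite size_map !size_iota ltnn.
case/allPn => v; rewrite mem_iota /= => vk /mapP nv.
exists v => [|j jk]; first by lia.
by apply/eqP => E; apply: nv; exists j => //; rewrite mem_iota.
Qed.

(* Every position which is not a record receives the least unused value. *)
Lemma greedy_filling (n : nat) (f : seq nat) (k : nat) :
  let F := nth 0%N (0%N :: f) in
  ballot n f -> (k <= n)%N ->
  exists g : nat -> nat, forall i, (i < k)%N ->
    [/\ (g i < F i.+1)%N,
        (F i < F i.+1)%N -> (g i).+1 = F i.+1,
        forall j, (j < i)%N -> g j != g i
      & (F i.+1 <= F i)%N -> forall v, (v < g i)%N -> exists2 j, (j < i)%N & g j = v].
Proof.
move=> F [sz mono bnd]; elim: k => [|k IH] lt_kn; first by exists id.
have {IH}[g Hg] := IH (ltnW lt_kn).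
have Fle i j : (i <= j <= n)%N -> (F i <= F j)%N.
  by case: i j => [|i] [|j] //= ij; apply: mono; lia.
suff [w [Hw1 Hw2 Hw3 Hw4]] : exists w,
    [/\ (w < F k.+1)%N,
        (F k < F k.+1)%N -> w.+1 = F k.+1,
        forall j, (j < k)%N -> g j != w
      & (F k.+1 <= F k)%N -> forall v, (v < w)%N -> exists2 j, (j < k)%N & g j = v].
  exists (fun i => if i == k then w else g i) => i; rewrite ltnS leq_eqVlt.
  case/orP=> [/eqP->|lt_ik]; rewrite ?eqxx.
    split=> // [j lt_jk|le v lt_vw]; first by rewrite (ltn_eqF lt_jk) Hw3.
    by have [j lt_jk E] := Hw4 le v lt_vw; exists j => //; rewrite (ltn_eqF lt_jk).
  have [H1 H2 H3 H4] := Hg i lt_ik; rewrite (ltn_eqF lt_ik); split=> // [j lt_ji|le v lt_v].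
    by rewrite (ltn_eqF (ltn_trans lt_ji lt_ik)) H3.
  by have [j lt_ji E] := H4 le v lt_v; exists j => //; rewrite (ltn_eqF (ltn_trans lt_ji lt_ik)).
have [v0 le_v0 unused] := exists_unused g k.
have lt_kF : (k < F k.+1)%N by have := bnd k lt_kn; rewrite /F /=; lia.
case: (ltnP (F k) (F k.+1)) => [rec|nrec].
  (* At a record the value is forced; it is new because all earlier values lie below [F k]. *)
  exists (F k.+1).-1; split=> [||j lt_jk|]; try lia.
  have [H1 _ _ _] := Hg j lt_jk; have := Fle j.+1 k; lia.
pose P v := all (fun j => g j != v) (iota 0 k).
have exP : exists v, P v.
  by exists v0; apply/allP => j; rewrite mem_iota => jk; apply: unused.
case: (ex_minnP exP) => w Pw minw; exists w; split=> [||j lt_jk|_ v lt_vw]; try lia.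
- suff : (w <= v0)%N by lia.
  by apply: minw; apply/allP => j; rewrite mem_iota => jk; apply: unused.
- by move/allP: Pw; apply; rewrite mem_iota.
- have : ~~ P v by apply/negP => /minw; lia.
  case/allPn => j; rewrite mem_iota /= negbK => jk /eqP E.
  by exists j.
Qed.

Lemma prefix_maxima_surj (n : nat) (f : seq nat) :
  ballot n f -> exists2 s : 'S_n, avoids321 s & prefix_maxima n s = f.
Proof.
move=> bf; have [g Hg] := greedy_filling n f n bf (leqnn n).
case: bf => sz mono bnd; set F := nth 0%N (0%N :: f) in Hg.
have Fle i j : (i <= j <= n)%N -> (F i <= F j)%N.
  by case: i j => [|i] [|j] //= ij; apply: mono; lia.
have lt_g (i : 'I_n) : (g i < n)%N.
  by have [H _ _ _] := Hg i (ltn_ord i); have := bnd i (ltn_ord i); rewrite /F /= in H; lia.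
have g_inj : injective (fun i : 'I_n => Ordinal (lt_g i)).
  move=> i j /(congr1 val)/= E; apply: val_inj => /=.
  have [_ _ Hi _] := Hg i (ltn_ord i); have [_ _ Hj _] := Hg j (ltn_ord j).
  by case: (ltngtP i j) => // [/Hj|/Hi]; rewrite E eqxx.
pose s := perm g_inj; have sE i : val (s i) = g i by rewrite permE.
have pmE i : (i <= n)%N -> prefix_max n s i = F i.
  elim: i => [|i IH] lt_in; first by rewrite prefix_max0.
  rewrite (prefix_maxS n s (Ordinal lt_in)) sE /= (IH (ltnW lt_in)).
  have [H1 H2 _ _] := Hg i lt_in; have le : (F i <= F i.+1)%N by apply: Fle; lia.
  by case: (ltnP (F i) (F i.+1)) => [/H2|]; lia.
exists s.
  apply/avoids321P => i j k /andP[ij jk]; rewrite !sE; apply/negP => /andP[kj ji].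
  have lt_jn := ltn_ord j.
  have [Hi _ _ _] := Hg i (ltn_ord i).
  have [_ Hj2 _ Hj4] := Hg j lt_jn.
  have [_ _ Hk3 _] := Hg k (ltn_ord k).
  have Fij : (F i.+1 <= F j)%N by apply: Fle; lia.
  case: (ltnP (F j) (F j.+1)) => [lt_F|/Hj4 H]; first by have := Hj2 lt_F; lia.
  have [l lj E] := H _ kj.
  by have := Hk3 l; rewrite E eqxx; lia.
apply: (@eq_from_nth _ 0%N); rewrite size_mkseq ?sz // => i lt_in.
by rewrite nth_mkseq // pmE.
Qed.

(** Listing them as images lets a sum over permutations be reindexed directly; [mem_ballots] gives
    the intrinsic description. *)
Definition ballots (n : nat) : seq (seq nat) :=
  [seq prefix_maxima n s | s <- enum [pred s : 'S_n | avoids321 s]].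

Lemma mem_ballots (n : nat) (f : seq nat) : f \in ballots n <-> ballot n f.
Proof.
split=> [/mapP[s _ ->]|/prefix_maxima_surj[s av <-]].
  exact: prefix_maxima_ballot.
by apply: map_f; rewrite mem_enum.
Qed.

Lemma ballots_uniq (n : nat) : uniq (ballots n).
Proof.
rewrite map_inj_in_uniq ?enum_uniq // => s s'; rewrite !mem_enum.
exact: prefix_maxima_inj.
Qed.

(** * First-return decomposition *)

(* In Dyck path language this is the first-return decomposition U g D h. *)
Definition glue (g h : seq nat) : seq nat :=
  map S g ++ (size g).+1 :: map (addn (size g).+1) h.

Lemma size_glue (g h : seq nat) : size (glue g h) = (size g + size h).+1.
Proof. by rewrite size_cat /= !size_map addnS. Qed.

Lemma nth_glue (g h : seq nat) (i : nat) :
  nth 0%N (glue g h) i =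
    if (i < size g)%N then (nth 0%N g i).+1
    else if (i == size g)%N then (size g).+1
    else if (i < (size g + size h).+1)%N
      then ((size g).+1 + nth 0 h (i - (size g).+1))%N else 0%N.
Proof.
rewrite nth_cat size_map; case: ltnP => [lt|le]; first by rewrite (nth_map 0%N).
case: eqVneq => [->|ne]; first by rewrite subnn.
have -> : (i - size g = (i - (size g).+1).+1)%N by lia.
rewrite /=; case: ltnP => [lt|ge]; first by rewrite (nth_map 0%N) //; lia.
by rewrite nth_default // size_map; lia.
Qed.

Lemma nth_glue_l (g h : seq nat) (i : nat) :
  (i < size g)%N -> nth 0%N (glue g h) i = (nth 0%N g i).+1.
Proof. by rewrite nth_glue => ->. Qed.

Lemma nth_glue_m (g h : seq nat) : nth 0%N (glue g h) (size g) = (size g).+1.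
Proof. by rewrite nth_glue ltnn eqxx. Qed.

Lemma nth_glue_r (g h : seq nat) (i : nat) :
  (i < size h)%N ->
  nth 0%N (glue g h) ((size g).+1 + i) = ((size g).+1 + nth 0 h i)%N.
Proof.
move=> lt_i; rewrite nth_glue; case: (ltnP _ (size g)) => [|_]; first by lia.
case: eqP => [|_]; first by lia.
by rewrite addSn ltnS ltn_add2l lt_i -addSn addKn.
Qed.

Lemma ballot_glue (m p : nat) (g h : seq nat) :
  ballot m g -> ballot p h -> ballot (m + p).+1 (glue g h).
Proof.
move=> [sg mg bg] [sh mh bh]; split=> [|i j ij|i lt_i].
- by rewrite size_glue sg sh.
- rewrite !nth_glue sg sh.
  case: (ltnP i m) => im; case: (ltnP j m) => jm; try lia.
  + by rewrite ltnS mg //; lia.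
  + have gi := bg i im; case: eqP => [|ne]; first by lia.
    by case: (ltnP j); lia.
  + case: eqP => ei; case: eqP => ej; try lia.
      by case: (ltnP j); lia.
    have hij := mh (i - m.+1)%N (j - m.+1)%N.
    by case: (ltnP i) => li; case: (ltnP j) => lj; lia.
- rewrite nth_glue sg sh.
  case: (ltnP i m) => im; first by have := bg i im; lia.
  case: eqP => ei; first by lia.
  by rewrite lt_i; have := bh (i - m.+1)%N; lia.
Qed.

(** The cut is the least [m] at which the entry is [m.+1], the first return. Before it, entry [i] is
    at least [i.+2], so lowering it by one keeps the ballot condition. *)
Lemma ballot_unglue (n : nat) (f : seq nat) :
  ballot n.+1 f -> exists m g h,
    [/\ (m <= n)%N, ballot m g, ballot (n - m) h & f = glue g h].
Proof.
move=> [sf mf bf].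
have exm : exists i, (nth 0%N f i == i.+1)%N.
  by exists n; have := bf n (ltnSn n); lia.
case: (ex_minnP exm) => m /eqP fm minm.
have le_mn : (m <= n)%N.
  by rewrite leqNgt; apply/negP => lt; move: fm; rewrite nth_default // sf.
have gt_f i : (i < m)%N -> (i.+1 < nth 0%N f i <= m.+1)%N.
  move=> im; have := bf i; have := mf i m; have := minm i.
  by case: (nth 0%N f i =P i.+1) => [->|ne]; lia.
pose g := map predn (take m f); pose h := map (subn^~ m.+1) (drop m.+1 f).
have sg : size g = m by rewrite size_map size_takel // sf; lia.
have sh : size h = (n - m)%N by rewrite size_map size_drop sf subSS.
have ng i : (i < m)%N -> nth 0%N g i = (nth 0%N f i).-1.
  by move=> im; rewrite (nth_map 0%N) ?nth_take // size_takel // sf; lia.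
have nh i : (i < n - m)%N -> nth 0%N h i = (nth 0%N f (m.+1 + i) - m.+1)%N.
  by move=> im; rewrite (nth_map 0%N) ?nth_drop // size_drop sf; lia.
exists m, g, h; split=> //.
- split=> // [i j ij|i im].
    by rewrite !ng; try lia; have := mf i j; lia.
  by rewrite ng //; have := gt_f i im; lia.
- split=> // [i j ij|i im].
    by rewrite !nh; try lia; have := mf (m.+1 + i)%N (m.+1 + j)%N; lia.
  by rewrite nh //; have := bf (m.+1 + i)%N; lia.
- apply: (@eq_from_nth _ 0%N) => [|i]; first by rewrite size_glue sg sh sf; lia.
  rewrite sf => lt_i; rewrite nth_glue sg sh.
  case: ltnP => im; first by rewrite ng //; have := gt_f i im; lia.
  case: eqP => [->//|ne].
  have -> : (i < (m + (n - m)).+1)%N by lia.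
  rewrite nh; last by lia.
  have -> : (m.+1 + (i - m.+1) = i)%N by lia.
  by have := bf i lt_i; lia.
Qed.

(** At index [m] the left side has [m.+1], while a longer [g'] would put at least [m.+2] there. *)
Lemma glue_size_le (m m' : nat) (g g' h h' : seq nat) :
  ballot m g -> ballot m' g' -> glue g h = glue g' h' -> (m' <= m)%N.
Proof.
move=> [sg _ _] [sg' _ bg'] E; rewrite leqNgt; apply/negP => lt_m.
have := congr1 (fun f => nth 0%N f m) E; rewrite /= !nth_glue sg sg' ltnn eqxx lt_m.
by have := bg' m lt_m; lia.
Qed.

Lemma glue_inj (m m' : nat) (g g' h h' : seq nat) :
  ballot m g -> ballot m' g' -> glue g h = glue g' h' -> g = g' /\ h = h'.
Proof.
move=> bg bg' E.
have le1 := glue_size_le _ _ _ _ _ _ bg bg' E.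
have le2 := glue_size_le _ _ _ _ _ _ bg' bg (esym E).
have sE : size g = size g' by case: bg bg' => -> _ _ [-> _ _]; lia.
move/eqP: E; rewrite /glue eqseq_cat ?size_map // eqseq_cons sE eqxx /=.
case/andP=> /eqP/inj_map-> //; last exact: succn_inj.
by move=> /eqP/inj_map-> //; exact: addnI.
Qed.

(** The last entry of a nonempty ballot sequence equals its length, so the entry before it is
    compared with the length: the path ends with UD. *)
Definition ends_at_record (g : seq nat) : bool :=
  (0 < size g)%N && (nth 0 (0 :: g) (size g).-1 < size g)%N.

(** * Weighted sums over ballot sequences *)

Section Weight.

Variable R : comNzRingType.
Implicit Type x : nat -> R.

(** The weights [x i] stay arbitrary so that replacing [t] by [q ^+ k * t] becomes a shift of the
    index by [k]. *)
Definition weight x (f : seq nat) : R :=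
  \prod_(0 <= i < size f | record_plateau f i) x i.

Lemma record_plateau_last (m : nat) (g : seq nat) :
  ballot m.+1 g -> record_plateau g m = false.
Proof.
move=> [sg _ bg]; rewrite /record_plateau [nth 0%N g m.+1]nth_default ?sg //.
by have := bg m (ltnSn m); lia.
Qed.

(** Raising entries by a constant preserves the record plateaus of [g] and [h]. Only position [m.-1]
    can become a new one: the last entry of [g], raised to [m.+1], equals the closing entry. *)
Lemma weight_glue x (m p : nat) (g h : seq nat) : ballot m g -> ballot p h ->
  weight x (glue g h) =
    (weight x g * (if ends_at_record g then x m.-1 else 1))
      * weight (fun i => x (m.+1 + i)%N) h.
Proof.
move=> bg bh; have [sg mg gb] := bg; have [sh mh hb] := bh.
rewrite /weight size_glue sg sh !(big_mkcond (record_plateau _)) /=.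
have le2 : (m.+1 <= (m + p).+1)%N by lia.
rewrite (big_cat_nat (n := m.+1)) //= big_nat_recr //=.
(* The closing entry [m.+1] is followed by a larger entry or by the default 0. *)
have -> : record_plateau (glue g h) m = false.
  rewrite /record_plateau !nth_glue sg sh ltnn eqxx.
  case: (ltnP m.+1 m) => [|_]; first by lia.
  case: (m.+1 =P m) => [|_]; first by lia.
  case: (ltnP m.+1) => lt; last by rewrite andbF.
  by have := hb (m.+1 - m.+1)%N; lia.
rewrite mulr1; congr (_ * _).
  rewrite /ends_at_record sg.
  case: m bg sg mg gb {le2} => [|m] bg sg mg gb; first by rewrite !big_geq // mulr1.
  rewrite !big_nat_recr //= (record_plateau_last m g bg) mulr1; congr (_ * _).
    apply: eq_big_nat => i /andP[_ im]; congr (if _ then _ else _).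
    rewrite /record_plateau !(nth_glue_l g h) ?sg ?eqSS; try lia.
    by case: i im => [|i] im; rewrite /= ?nth_glue_l ?sg //; have := gb 0%N; lia.
  congr (if _ then _ else _); rewrite /record_plateau.
  have gm : nth 0%N g m = m.+1 by have := gb m; lia.
  rewrite -{1}sg nth_glue_m nth_glue_l sg // gm eqxx andbT.
  by case: m bg sg mg gb gm => [|m] bg sg mg gb gm //=; rewrite nth_glue_l ?sg.
rewrite -{1}[m.+1]add0n big_addn.
have -> : ((m + p).+1 - m.+1 = p)%N by lia.
apply: eq_big_nat => i /andP[_ ip]; rewrite [(i + m.+1)%N]addnC.
congr (if _ then _ else _); rewrite /record_plateau -sg nth_glue_r ?sh //.
have hi := hb i ip; congr (_ && _).
  case: i ip hi => [|i] ip hi; first by rewrite addn0 /= nth_glue_m; lia.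
  by rewrite addnS /= nth_glue_r ?sh ?ltn_add2l //; lia.
rewrite -addnS; case: (ltnP i.+1 p) => [lt|ge].
  by rewrite nth_glue_r ?sh // eqn_add2l.
rewrite [nth _ (glue g h) _]nth_default ?size_glue ?sh; last by lia.
by rewrite [nth _ h i.+1]nth_default ?sh; lia.
Qed.

(** The new entry exceeds all entries of [g], so it creates no plateau before it, and the last
    position never counts. *)
Lemma weight_rcons x (m : nat) (g : seq nat) :
  ballot m g -> weight x (rcons g m.+1) = weight x g.
Proof.
move=> bg; have [sg mg gb] := bg.
rewrite /weight size_rcons sg !(big_mkcond (record_plateau _)) /=.
rewrite big_nat_recr //= {2}/record_plateau.
rewrite [nth _ _ m.+1]nth_default ?size_rcons ?sg // nth_rcons sg ltnn eqxx andbF mulr1.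
apply: eq_big_nat => i /andP[_ im]; congr (if _ then _ else _).
rewrite /record_plateau -rcons_cons !nth_rcons /= sg im ltnS (ltnW im).
case: (ltnP i.+1 m) => // ge; have E : i.+1 = m by lia.
rewrite E eqxx [nth 0%N g m]nth_default ?sg //.
by have := gb i im; lia.
Qed.

Definition weight_sum (n : nat) x : R := \sum_(f <- ballots n) weight x f.

(* [weight_glue] shows that closing [g] into the prime [glue g [::]] creates
   the extra factor [x m.-1] exactly when [g] ends at a record. *)
Definition prime_sum (m : nat) x : R :=
  \sum_(g <- ballots m) weight x g * (if ends_at_record g then x m.-1 else 1).

Lemma ballots0 : perm_eq (ballots 0) [:: [::]].
Proof.
apply: uniq_perm; rewrite ?ballots_uniq // => f; rewrite inE.
apply/idP/eqP => [/mem_ballots[/size0nil]//|->].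
by apply/mem_ballots; split=> // i j; lia.
Qed.

Lemma weight_sum0 x : weight_sum 0 x = 1.
Proof. by rewrite /weight_sum (perm_big _ ballots0) big_seq1 /weight big_geq. Qed.

Lemma prime_sum0 x : prime_sum 0 x = 1.
Proof.
by rewrite /prime_sum (perm_big _ ballots0) big_seq1 /weight big_geq // mulr1.
Qed.

(** This deletes a final UD: the last entry is [m.+1] and the one before it is at most [m], so by
    monotonicity the rest is a ballot sequence of size [m]. *)
Lemma ballots_ending_at_record (m : nat) :
  perm_eq [seq g <- ballots m.+1 | ends_at_record g]
          [seq rcons g m.+1 | g <- ballots m].
Proof.
apply: uniq_perm; first by rewrite filter_uniq ?ballots_uniq.
  by rewrite map_inj_uniq ?ballots_uniq //; apply: rcons_injl.
move=> f; rewrite mem_filter; apply/andP/mapP => [[]|[g /mem_ballots[sg mg bg] ->]].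
  rewrite /ends_at_record => E /mem_ballots[]; case/lastP: f E => [//|g v].
  rewrite size_rcons /= -rcons_cons nth_rcons /= ltnSn => lt [sg] mf bf.
  rewrite sg in lt.
  have nf i : (i < m)%N -> nth 0%N (rcons g v) i = nth 0%N g i.
    by rewrite nth_rcons sg => ->.
  have Ev : v = m.+1.
    by have := bf m (ltnSn m); rewrite nth_rcons sg ltnn eqxx; lia.
  exists g; last by rewrite Ev.
  apply/mem_ballots; split=> // [i j ij|i im].
    by rewrite -!nf; try lia; apply: mf; lia.
  have := bf i; rewrite nf // => H.
  suff : (nth 0%N g i <= m)%N by lia.
  have := mf i m.-1; rewrite !nf; try lia.
  by case: m sg mf bf lt nf Ev im H => //= m sg mf bf lt nf Ev im H; lia.
split.
  rewrite /ends_at_record size_rcons /= -rcons_cons nth_rcons /= ltnSn sg.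
  by case: m sg mg bg => //= m sg mg bg; have := bg m; lia.
apply/mem_ballots; split=> [|i j ij|i im]; first by rewrite size_rcons sg.
  rewrite !nth_rcons sg; have := bg i; case: (ltnP i m) => im; case: (ltnP j m) => jm; try lia.
  - by move=> _; apply: mg; lia.
  - by case: eqP; lia.
  - by do 2 case: eqP; lia.
rewrite nth_rcons sg; have := bg i; case: ltnP => ?; first by lia.
by case: eqP; lia.
Qed.

(** The correction [x m - 1] is collected by the sequences ending at a record; deleting their last
    entry preserves the weight. *)
Lemma prime_sumS (m : nat) x :
  prime_sum m.+1 x = weight_sum m.+1 x + (x m - 1) * weight_sum m x.
Proof.
have -> : weight_sum m x = \sum_(g <- ballots m.+1 | ends_at_record g) weight x g.
  rewrite -big_filter (perm_big _ (ballots_ending_at_record m)) big_map /=.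
  rewrite /weight_sum !big_seq; apply: eq_bigr => g /mem_ballots bg.
  by rewrite weight_rcons.
rewrite /prime_sum /weight_sum big_distrr /= [X in _ + X]big_mkcond -big_split /=.
by apply: eq_bigr => g _; case: ifP => _; ring.
Qed.

Lemma ballots_glue (n : nat) :
  perm_eq (ballots n.+1)
    [seq glue p.1 p.2 | m <- index_iota 0 n.+1,
                        p <- [seq (g, h) | g <- ballots m, h <- ballots (n - m)]].
Proof.
apply: uniq_perm; first exact: ballots_uniq.
  apply: allpairs_uniq_dep => [|m _|]; first exact: iota_uniq.
    by apply: allpairs_uniq; rewrite ?ballots_uniq // => [] [g h] [g' h'] _ _ [-> ->].
  move=> _ _ /allpairsPdep[m [p [_ p_in ->]]] /allpairsPdep[m' [p' [_ p'_in ->]]].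
  case/allpairsP: p_in => -[g h] [/= /mem_ballots bg _ ->].
  case/allpairsP: p'_in => -[g' h'] [/= /mem_ballots bg' _ ->] /= E.
  have [Eg Eh] := glue_inj _ _ _ _ _ _ bg bg' E.
  have Em : m = m' by case: bg bg' => <- _ _ [<- _ _]; rewrite Eg.
  by rewrite Eg Eh Em.
move=> f; apply/idP/allpairsPdep.
  move=> /mem_ballots/ballot_unglue[m [g [h [le_mn bg bh ->]]]].
  exists m, (g, h); split=> //; first by rewrite mem_index_iota.
  by apply/allpairsP; exists (g, h); split=> //; apply/mem_ballots.
move=> [m [p [lt_m /allpairsP[[g h] [/= /mem_ballots bg /mem_ballots bh ->]] ->]]].
apply/mem_ballots => /=; move: lt_m; rewrite mem_index_iota => lt_m.
have -> : n.+1 = (m + (n - m)).+1 by lia.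
exact: ballot_glue.
Qed.

Lemma weight_sum_first (n : nat) x :
  weight_sum n.+1 x =
    \sum_(0 <= m < n.+1)
       prime_sum m x * weight_sum (n - m) (fun i => x (m.+1 + i)%N).
Proof.
rewrite /weight_sum (perm_big _ (ballots_glue n)) big_allpairs_dep /=.
apply: eq_bigr => m _; rewrite big_allpairs_dep /= /prime_sum big_distrl /=.
rewrite !big_seq; apply: eq_bigr => g /mem_ballots bg.
rewrite big_distrr /= !big_seq; apply: eq_bigr => h /mem_ballots bh.
exact: weight_glue bg bh.
Qed.

Lemma eq_weight_sum (n : nat) x y : x =1 y -> weight_sum n x = weight_sum n y.
Proof. by move=> E; apply: eq_bigr => f _; apply: eq_bigr => i _. Qed.

Lemma eq_prime_sum (n : nat) x y : x =1 y -> prime_sum n x = prime_sum n y.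
Proof.
move=> E; apply: eq_bigr => f _; rewrite E; congr (_ * _).
by apply: eq_bigr => i _.
Qed.

(* Iterating the first-prime decomposition cuts a ballot sequence into primes;
   regrouping the same products around the last prime gives this identity. *)
Lemma weight_sum_last (n : nat) x :
  weight_sum n.+1 x =
    \sum_(0 <= m < n.+1)
       weight_sum m x * prime_sum (n - m) (fun i => x (m + i)%N).
Proof.
elim/ltn_ind: n x => n IH x; rewrite weight_sum_first.
(* The terms [m = n] on the left and [m = 0] on the right both count the paths with a single
   prime. *)
rewrite [RHS]big_nat_recl // big_nat_recr //= subnn subn0 weight_sum0 mulr1.
rewrite weight_sum0 mul1r addrC; congr (_ + _).
(* By induction, the tail after the first prime is split around its last prime. *)
transitivity (\sum_(0 <= m < n) \sum_(0 <= l < n - m)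
    prime_sum m x * (weight_sum l (fun i => x (m.+1 + i)%N)
      * prime_sum (n - m.+1 - l) (fun i => x (m.+1 + (l + i))%N))).
  apply: eq_big_nat => m /andP[_ lt_mn]; rewrite -big_distrr /=; congr (_ * _).
  have -> : (n - m = (n - m.+1).+1)%N by lia.
  by rewrite IH //; lia.
(* After shifting [l] by [m], the last prime starts at [l.+1] whatever [m] is, so the sums can be
   exchanged. *)
transitivity (\sum_(0 <= m < n) \sum_(m <= l < n)
    prime_sum m x * (weight_sum (l - m) (fun i => x (m.+1 + i)%N)
      * prime_sum (n - l.+1) (fun i => x (l.+1 + i)%N))).
  apply: eq_big_nat => m /andP[_ lt_mn].
  symmetry; rewrite -{1}[m]add0n big_addn; apply: eq_big_nat => l /andP[_ lt_l].
  rewrite addnK; congr (_ * (_ * _)).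
  have -> : (n - m.+1 - l = n - (l + m).+1)%N by lia.
  by apply: eq_prime_sum => i; congr (x _); lia.
transitivity (\sum_(0 <= m < n) \sum_(0 <= l < n | (m <= l)%N)
    prime_sum m x * (weight_sum (l - m) (fun i => x (m.+1 + i)%N)
      * prime_sum (n - l.+1) (fun i => x (l.+1 + i)%N))).
  by apply: eq_bigr => m _; rewrite (big_nat_widenl m 0).
rewrite (exchange_big_dep_nat xpredT) //=.
apply: eq_big_nat => l /andP[_ lt_ln].
(* The inner sum over [m] is the first-prime decomposition of [weight_sum l.+1]. *)
rewrite weight_sum_first big_distrl /= (big_nat_widen 0 l.+1 n) //=.
by apply: eq_big => [m|m _]; rewrite ?ltnS ?mulrA.
Qed.

End Weight.

(** * Specialisation to the polynomials [M] *)

Lemma weight_prefix_maxima (R : comNzRingType) (x : nat -> R) (n : nat) (s : 'S_n) :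
  avoids321 s -> weight R x (prefix_maxima n s) = \prod_(i < n | is_descent s i) x i.
Proof.
move=> av; rewrite /weight size_mkseq big_mkord.
by apply: eq_bigl => i; rewrite descent_record_plateau.
Qed.

(** Composition fixes the constant [q] and sends [t] to [u]; over the descents the factors
    [q ^+ i.+1] multiply to [q ^+ maj s]. *)
Lemma M_weight_sum (n : nat) (u : Zqt) :
  M n u = weight_sum _ n (fun i => q ^+ i.+1 * u).
Proof.
rewrite /M /Mpoly /weight_sum big_map big_enum /= raddf_sum /=.
apply: eq_bigr => s av; rewrite weight_prefix_maxima //.
rewrite rmorphM !rmorphXn /= comp_polyX comp_polyC -/q /maj /des.
rewrite big_split /= prodrXr; congr (_ * _).
by rewrite prodr_const; congr (_ ^+ _); apply: eq_card => i; rewrite inE.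
Qed.

Lemma M_weight_sum_shift (n k : nat) :
  M n (q ^+ k * t) = weight_sum _ n (fun i => q ^+ (k + i).+1 * t).
Proof.
rewrite M_weight_sum; apply: eq_weight_sum => i.
by rewrite mulrA -exprD; congr (q ^+ _ * t); lia.
Qed.

Theorem theorem6p2 (n : nat) (hn : (1 <= n)%N) :
  M n t = M (n - 1) (q * t)
        + \sum_(2 <= k < n.+1)
            (M (k - 1) t + (q ^+ (k - 1) * t - 1) * M (k - 2) t)
              * M (n - k) (q ^+ k * t)
  /\
  M n t = M (n - 1) t
        + \sum_(0 <= k < n - 1)
            M k t * (M (n - k - 1) (q ^+ k * t)
                     + (q ^+ (n - 1) * t - 1) * M (n - k - 2) (q ^+ k * t)).
Proof.
case: n hn => // n _; split.
  rewrite {1}M_weight_sum weight_sum_first big_nat_recl //= prime_sum0 mul1r subn0.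
  congr (_ + _); first by rewrite -[q in RHS]expr1 M_weight_sum_shift subn1.
  (* Shifting the index by 2 turns the bracket into [prime_sum k.+1]; the empty [g] gave the term
     outside the sum. *)
  rewrite (big_addn 0 n.+2 2) subSS subn1 /=; apply: eq_big_nat => k /andP[_ lt_k].
  have -> : (k + 2 - 1 = k.+1)%N by lia.
  rewrite addnK prime_sumS -!M_weight_sum M_weight_sum_shift; congr (_ * _).
  have -> : (n.+1 - (k + 2) = n - k.+1)%N by lia.
  by apply: eq_weight_sum => i; congr (q ^+ _ * t); lia.
rewrite {1}M_weight_sum weight_sum_last big_nat_recr //= subnn prime_sum0 mulr1 addrC.
rewrite -M_weight_sum subn1; congr (_ + _).
apply: eq_big_nat => k /andP[_ lt_k]; rewrite -M_weight_sum; congr (_ * _).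
have -> : (n - k = (n - k - 1).+1)%N by lia.
rewrite prime_sumS !M_weight_sum_shift.
have -> : (n.+1 - k - 1 = (n - k - 1).+1)%N by lia.
have -> : (n.+1 - k - 2 = n - k - 1)%N by lia.
(* The shift by [k] cancels, so the correction carries the same power of [q] for every [k]. *)
by have -> : ((k + (n - k - 1)).+1 = n)%N by lia.
Qed.
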